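(* Let $R$ be a ring and $M$ a left $R$-module. Then the following statements are equivalent: (1) $M^{(\mathbb{N})}$ (the direct sum of countably many copies of $M$) is semi-compact; (2) $R$ satisfies the ascending chain condition on the left ideals in $\mathcal{A}_l(R,M)$ (equivalently, $M$ satisfies the descending chain condition on the subgroups in $\mathcal{A}_r(R,M)$); (3) $M$ satisfies the descending chain condition on the subgroups of $M$ which are annihilators of finitely generated left ideals of $R$, i.e. the subgroups $M[I]$ with $I$ a finitely generated left ideal of $R$; (4) $M$ is $\Sigma$-semi-compact.
   Context: Rings are associative with identity and modules are unitary. For a subset $X$ of $M$, ${}^{\bot}X=\{r\in R\mid rX=0\}$, and $\mathcal{A}_l(R,M)$ is the set of left ideals of $R$ of this form. For a subset (e.g. left ideal) $X$ of $R$, $M[X]=\{m\in M\mid Xm=0\}$, and $\mathcal{A}_r(R,M)$ is the set of subgroups of $M$ of this form. A left $R$-module $N$ is semi-compact if every set of congruences $x\equiv x_\alpha\pmod{N[I_\alpha]}$ ($\alpha\in\Lambda$, $x_\alpha\in N$, $I_\alpha$ a left ideal of $R$), each finite subset of which has a common solution in $N$, has a simultaneous solution in $N$. $M$ is $\Sigma$-semi-compact if all direct sums of copies of $M$ (over arbitrary index sets) are semi-compact. *)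

(* Defs.v *)
From HB Require Import structures.
From mathcomp Require Import all_boot all_algebra.
From mathcomp Require Import boolp classical_sets functions cardinality.

Set Implicit Arguments.
Unset Strict Implicit.
Unset Printing Implicit Defensive.

Import GRing.Theory.

Local Open Scope classical_set_scope.
Local Open Scope ring_scope.

Section DirectSum.
Variables (R : pzRingType) (M : lmodType R) (L : Type).

Definition finsupp : {pred L -> M} :=
  fun f => `[< finite_set [set i | f i != 0] >].

Lemma finsupp_submod_closed : submod_closed finsupp.
Proof.
split=> [|a f g /asboolP ff /asboolP fg]; apply/asboolP.
  rewrite (_ : [set _ | _] = set0); first exact: finite_set0.
  by apply/seteqP; split=> i //=; rewrite eqxx.
apply: (@sub_finite_set _ _ ([set i | f i != 0] `|` [set i | g i != 0])).
  move=> i /= fgi; have [fi0|] := eqVneq (f i) 0; last by left.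
  right; apply: contra_neq fgi => gi0.
  by change (a *: f i + g i = 0); rewrite fi0 gi0 scaler0 addr0.
by rewrite finite_setU.
Qed.

HB.instance Definition _ := GRing.isSubmodClosed.Build R (L -> M) finsupp
  finsupp_submod_closed.

(* The direct sum of copies of M indexed by L: the finitely supported functions
   L -> M, as a submodule of L -> M with its pointwise operations. *)
Record dsum := DSum { dsum_val :> L -> M; _ : dsum_val \in finsupp }.

HB.instance Definition _ := [isSub for dsum_val].
HB.instance Definition _ := [Choice of dsum by <:].
HB.instance Definition _ := [SubChoice_isSubLmodule of dsum by <:].

End DirectSum.

Arguments dsum {R} M L.

(* Submodules of R^o (R acting on itself by left multiplication) are left
   ideals; R itself is allowed. *)
Definition left_ideal (R : pzRingType) (I : set R) : Prop :=
  submod_closed (fun r : R^o => r \in I).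

Definition fg_left_ideal (R : pzRingType) : set (set R) :=
  [set I | exists s : seq R, I = smallest (@left_ideal R) [set` s]].

Arguments fg_left_ideal : clear implicits.

Section Annihilators.
Variables (R : pzRingType) (M : lmodType R).

Definition annl (X : set M) : set R :=
  [set r | forall m, X m -> r *: m = 0].

Definition annr (X : set R) : set M :=
  [set m | forall r, X r -> r *: m = 0].

End Annihilators.

Arguments annl {R} M X.
Arguments annr {R} M X.

Definition annl_ideals (R : pzRingType) (M : lmodType R) : set (set R) :=
  range (annl M).

Definition annr_subgroups (R : pzRingType) (M : lmodType R) : set (set M) :=
  range (annr M).

Arguments annl_ideals {R} M _.
Arguments annr_subgroups {R} M _.

Definition acc (T : Type) (C : set (set T)) : Prop :=
  forall A : nat -> set T, (forall n, C (A n)) ->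
    (forall n, A n `<=` A n.+1) ->
  exists n0 : nat, forall n, (n0 <= n)%N -> A n = A n0.

Definition dcc (T : Type) (C : set (set T)) : Prop :=
  forall A : nat -> set T, (forall n, C (A n)) ->
    (forall n, A n.+1 `<=` A n) ->
  exists n0 : nat, forall n, (n0 <= n)%N -> A n = A n0.

Definition semi_compact (R : pzRingType) (N : lmodType R) : Prop :=
  forall (L : Type) (x : L -> N) (I : L -> set R),
    (forall i, left_ideal (I i)) ->
    (forall F : set L, finite_set F ->
       exists y : N, forall i, F i -> annr N (I i) (y - x i)) ->
  exists y : N, forall i, annr N (I i) (y - x i).

Definition sigma_semi_compact (R : pzRingType) (M : lmodType R) : Prop :=
  forall L : Type, semi_compact (dsum M L).

(* Main.v *)
Require Import Defs.
From mathcomp Require Import all_boot all_algebra.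
From mathcomp Require Import boolp classical_sets.
From mathcomp Require Import cardinality.

(** The maps [annl M] and [annr M] form a Galois connection between subsets of
    [M] and subsets of [R], so ascending chains of annihilator left ideals and
    descending chains of annihilator subgroups determine each other.  In a direct
    sum of copies of [M], annihilators are computed coordinatewise ([annr_dsum]).
    This links semi-compactness of direct sums to chains in [M] in both
    directions.

    If the countable direct sum is semi-compact, an ascending chain [A n] of
    annihilator left ideals must stop ([acc_of_semi_compact]): choose [m n]
    annihilated by [A n], but not by [A n.+1] whenever [A n] and [A n.+1] differ.
    The truncations [(m 0, ..., m n.-1, 0, 0, ...)] are compatible modulo the
    annihilators of the [A n], and a simultaneous solution has a nonzero
    coordinate at every [n] at which the chain grows.  Its support is finite.

    Conversely, the chain condition for annihilators of finitely generated left
    ideals implies that every subset [S] of [R] has a finite subset with the same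
    annihilator in [M] ([finite_annr]).  For a family of congruences modulo the
    annihilators of the [I i], apply this to the union of the [I i]: the finite
    subset meets only finitely many [I i], and a solution of these finitely many
    congruences solves them all ([sigma_semi_compact_of_dcc]). *)

Set Implicit Arguments.
Unset Strict Implicit.
Unset Printing Implicit Defensive.

Import GRing.Theory.

Local Open Scope classical_set_scope.
Local Open Scope ring_scope.

Section Annihilators.
Variables (R : pzRingType) (M : lmodType R).

Lemma annr_anti (X Y : set R) : X `<=` Y -> annr M Y `<=` annr M X.
Proof. by move=> sXY m Ym r /sXY; apply: Ym. Qed.

Lemma annl_anti (X Y : set M) : X `<=` Y -> annl M Y `<=` annl M X.
Proof. by move=> sXY r Yr m /sXY; apply: Yr. Qed.

Lemma annrK (X : set R) : annr M (annl M (annr M X)) = annr M X.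
Proof.
apply/seteqP; split=> m mX r rX; first by apply: mX => n; apply.
exact: rX.
Qed.

Lemma annlK (X : set M) : annl M (annr M (annl M X)) = annl M X.
Proof.
apply/seteqP; split=> r rX m mX; first by apply: rX => s; apply.
exact: mX.
Qed.

Lemma left_ideal_annl (X : set M) : left_ideal (annl M X).
Proof.
split=> [|a r s /set_mem rX /set_mem sX]; apply/mem_set => m Xm.
  exact: scale0r.
change ((a * r + s) *: m = 0).
by rewrite scalerDl -scalerA rX // sX // scaler0 addr0.
Qed.

(** The elements of [R] killing a given [m] form a left ideal, so [m] is killed
    by a generated left ideal as soon as it is killed by the generators. *)
Lemma annr_smallest (X : set R) :
  annr M (smallest (@left_ideal R) X) = annr M X.
Proof.
apply/seteqP; split; first by apply: annr_anti; apply: sub_smallest.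
move=> m Xm r Xr.
suff : annl M [set m] r by apply.
by apply: Xr; split=> [|s Xs n ->]; [apply: left_ideal_annl|apply: Xm].
Qed.

Lemma dcc_annr_of_acc_annl : acc (annl_ideals M) -> dcc (annr_subgroups M).
Proof.
move=> accM A AM Adec.
have AK n : annr M (annl M (A n)) = A n by have [X _ <-] := AM n; apply: annrK.
have [||n0 stab] := accM (fun n => annl M (A n)).
- by move=> n; exists (A n).
- by move=> n; apply: annl_anti.
by exists n0 => n /stab An; rewrite -AK An AK.
Qed.

(** Otherwise each finite subset of [S] could be enlarged by an element of [S]
    so as to shrink its annihilator, giving a strictly decreasing chain. *)
Lemma finite_annr (S : set R) :
    dcc [set annr M I | I in fg_left_ideal R] ->
  exists2 s : seq R, [set` s] `<=` S & annr M [set` s] `<=` annr M S.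
Proof.
move=> dccM; apply: contrapT => noS.
have /choice[f fP] (s : seq R) : exists r, [set` s] `<=` S ->
      S r /\ ~ annr M [set` s] `<=` annr M [set r].
  have [sS|nsS] := pselect ([set` s] `<=` S); last by exists 0 => /nsS.
  apply: contrapT => nor; apply: noS; exists s => // m sm r Sr.
  apply: contrapT => rm; apply: nor; exists r => _; split=> // /(_ m sm).
  by move=> /(_ r erefl).
pose s n := iter n (fun t => f t :: t) [::].
have sS n : [set` s n] `<=` S.
  elim: n => [//|n IHn] r /=; rewrite inE => /predU1P[->|/IHn //].
  by have [] := fP _ IHn.
have [||n0 stab] := dccM (fun n => annr M [set` s n]).
- move=> n; exists (smallest (@left_ideal R) [set` s n]); first by exists (s n).
  exact: annr_smallest.
- by move=> n; apply: annr_anti => r /= rs; rewrite inE rs orbT.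
have [_] := fP _ (sS n0); apply.
rewrite -(stab n0.+1) //; apply: annr_anti => r -> /=.
exact: mem_head.
Qed.

End Annihilators.

Section DirectSums.
Variables (R : pzRingType) (M : lmodType R).

Lemma annr_dsum (L : Type) (I : set R) (y : dsum M L) :
  annr (dsum M L) I y <-> forall l, annr M I (y l).
Proof.
split=> [Iy l r Ir|Iy r Ir]; last by apply/val_inj/funext => l; apply: Iy.
by change ((r *: y) l = 0); rewrite Iy.
Qed.

Lemma annrB (I : set R) (m n : M) :
  annr M I m -> annr M I n -> annr M I (m - n).
Proof. by move=> Im In r Ir; rewrite scalerBr Im // In // subr0. Qed.

Lemma trunc_finsupp (m : nat -> M) (n : nat) :
  (fun i => if (i < n)%N then m i else 0) \in @finsupp R M nat.
Proof.
apply/asboolP; apply: (sub_finite_set _ (finite_II n)) => i /=.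
by case: ifP => //; rewrite eqxx.
Qed.

Definition trunc (m : nat -> M) (n : nat) : dsum M nat :=
  DSum (trunc_finsupp m n).

(** If [m i] is killed by [A i], then [trunc m k] solves the congruences
    [y = trunc m n] modulo the annihilator of [A n] for all [n] up to [k],
    because the entries of the difference are [m i] with [n <= i < k]. *)
Lemma trunc_congr (A : nat -> set R) (m : nat -> M) (n k : nat) :
    {homo A : i j / (i <= j)%N >-> i `<=` j} ->
    (forall i, annr M (A i) (m i)) -> (n <= k)%N ->
  annr (dsum M nat) (A n) (trunc m k - trunc m n).
Proof.
move=> Ainc Am le_nk; apply/annr_dsum => i.
change (annr M (A n) ((if (i < k)%N then m i else 0)
                      - (if (i < n)%N then m i else 0))).
have [lt_in|le_ni] := ltnP i n.
  by rewrite (leq_trans lt_in le_nk) subrr => r _; rewrite scaler0.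
rewrite subr0; case: ifP => _ r; last by rewrite scaler0.
by move=> /(Ainc _ _ le_ni); apply: Am.
Qed.

Lemma finite_nat_bound (F : set nat) :
  finite_set F -> exists k, forall n, F n -> (n < k)%N.
Proof.
move=> /finite_seqP[s ->]; exists (\max_(i <- s) i).+1 => n /= ns.
by rewrite ltnS (big_rem n) //= leq_maxl.
Qed.

Lemma acc_of_semi_compact :
  semi_compact (dsum M nat) -> acc (annl_ideals M).
Proof.
move=> scM A AM Aasc.
have AK n : annl M (annr M (A n)) = A n by have [X _ <-] := AM n; apply: annlK.
have Ainc : {homo A : i j / (i <= j)%N >-> i `<=` j}.
  by apply: homo_leq => [X //|Y X Z|//]; apply: subset_trans.
have /choice[m mP] n : exists m, annr M (A n) m /\
      (annr M (A n.+1) m -> A n.+1 = A n).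
  have [sA|] := pselect (annr M (A n) `<=` annr M (A n.+1)).
    exists 0; split=> [r _|_]; first exact: scaler0.
    rewrite -[LHS]AK -[RHS]AK; congr annl.
    by apply/seteqP; split=> //; apply: annr_anti.
  by move=> /existsNP[m /not_implyP[Am nAm]]; exists m.
have [||y yP] := scM nat (trunc m) A.
- by move=> n; rewrite -AK; apply: left_ideal_annl.
- move=> F /finite_nat_bound[k Fk]; exists (trunc m k) => n /Fk /ltnW le_nk.
  by apply: trunc_congr => // i; have [] := mP i.
have [k yk] : exists k, forall n, y n != 0 -> (n < k)%N.
  by apply: finite_nat_bound; apply/asboolP; case: (y).
have Astep n : (k <= n)%N -> A n.+1 = A n.
  move=> le_kn; have [_] := mP n; apply.
  (* trunc m n.+1 is the first truncation that keeps the entry m n, and y n = 0,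
     so the congruence of index n.+1 says that A n.+1 kills m n. *)
  have /annr_dsum/(_ n) := yP n.+1.
  change (annr M (A n.+1) (y n - (if (n < n.+1)%N then m n else 0)) ->
    annr M (A n.+1) (m n)).
  have /eqP -> : y n == 0 by apply: contraLR le_kn => /yk; rewrite -ltnNge.
  by rewrite ltnSn sub0r => Am r /Am /eqP; rewrite scalerN oppr_eq0 => /eqP.
exists k; elim=> [|n IHn]; first by rewrite leqn0 => /eqP ->.
rewrite leq_eqVlt => /predU1P[-> //|]; rewrite ltnS => le_kn.
by rewrite Astep // IHn.
Qed.

Lemma finite_subcover (L : Type) (T : eqType) (I : L -> set T) (s : seq T) :
    [set` s] `<=` \bigcup_i I i ->
  exists2 F : set L, finite_set F & [set` s] `<=` \bigcup_(i in F) I i.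
Proof.
elim: s => [|r s IHs] sI; first by exists set0; first exact: finite_set0.
have [|F finF sF] := IHs.
  by move=> t ts; apply: sI; rewrite /= inE ts orbT.
have [i _ Ir] := sI r (mem_head r s).
exists ([set i] `|` F).
  by rewrite finite_setU; split; first exact: finite_set1.
move=> t /=; rewrite inE => /predU1P[->|/sF[j Fj It]].
  by exists i; first by left.
by exists j; first by right.
Qed.

Lemma sigma_semi_compact_of_dcc :
  dcc [set annr M I | I in fg_left_ideal R] -> sigma_semi_compact M.
Proof.
move=> dccM L K x I _ solF.
have [s sI annrs] := finite_annr (\bigcup_i I i) dccM.
have [F finF sF] := finite_subcover sI.
have [y yF] := solF F finF.
exists y => i.
(* y is compared with a solution y' of one more congruence: they differ by an
   element killed by s, hence by I i. *)
have [|y' yF'] := solF ([set i] `|` F).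
  by rewrite finite_setU; split; first exact: finite_set1.
have /annr_dsum y'i : annr (dsum M L) (I i) (y' - x i) by apply: yF'; left.
apply/annr_dsum => l.
suff y'y : annr M (I i) (y' l - y l).
  have -> : (y - x i) l = (y' - x i) l - (y' l - y l).
    change (y l - x i l = y' l - x i l - (y' l - y l)).
    by rewrite opprB [RHS]addrC addrA subrK.
  exact: annrB.
have sub_I : I i `<=` \bigcup_j I j by move=> r Ir; exists i.
apply: (annr_anti sub_I); apply: annrs => r /sF[j Fj Ir].
have /annr_dsum/(_ l) y'j : annr (dsum M L) (I j) (y' - x j).
  by apply: yF'; right.
have /annr_dsum/(_ l) yj := yF j Fj.
have -> : y' l - y l = (y' - x j) l - (y - x j) l.
  change (y' l - y l = y' l - x j l - (y l - x j l)).
  by rewrite opprB addrA subrK.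
exact: annrB y'j yj r Ir.
Qed.

End DirectSums.

Theorem theorem2p1 (R : pzRingType) (M : lmodType R) :
  [<-> semi_compact (dsum M nat);
       acc (annl_ideals M);
       dcc (annr_subgroups M);
       dcc [set annr M I | I in fg_left_ideal R]%classic;
       sigma_semi_compact M].
Proof.
tfae.
- exact: acc_of_semi_compact.
- exact: dcc_annr_of_acc_annl.
- by move=> dccM A AM; apply: dccM => n; have [I _ <-] := AM n; exists I.
- exact: sigma_semi_compact_of_dcc.
- exact.
Qed.
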